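(* Let $\mathcal{R}_i:\mathbb{X}^i\to\mathbb{Y}^i$ ($i=1,\dots,m$) be local randomizers and let $\mathcal{R}^{\times}_{[1:m]}(x^1,\dots,x^m)=(\mathcal{R}_1(x^1),\dots,\mathcal{R}_m(x^m))$ be their joint composition. Let $\boldsymbol{x}_1=(x_1^1,\dots,x_1^m)$ and $\bar{\boldsymbol{x}}_1=(\bar x_1^1,\dots,\bar x_1^m)$ be two elements of $\mathbb{X}^1\times\cdots\times\mathbb{X}^m$. Then the Cartesian product of the primary optimal decompositions of the $\mathcal{R}_i$ with respect to $(x_1^i,\bar x_1^i)$, $i=1,\dots,m$, is an optimal decomposition of $\mathcal{R}^{\times}_{[1:m]}$ with respect to $(\boldsymbol{x}_1,\bar{\boldsymbol{x}}_1)$; and the same holds for the Cartesian product of the simplified optimal decompositions of the $\mathcal{R}_i$.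
   Context: All $\mathbb{Y}^i$ are finite. A local randomizer $\mathcal{R}:\mathbb{X}\to\mathbb{Y}$ is a randomized map; $\mathcal{R}(x)$ is its output distribution on input $x$ and $\mathcal{R}(x)(y)$ the probability of $y$. In the joint composition the $\mathcal{R}_i$ use independent randomness. General clone decomposition of $\mathcal{R}:\mathbb{X}\to\mathbb{Y}$ with respect to $(u,\bar u)\in\mathbb{X}^2$: a finite family of probability distributions $(Q^j)_{j\in J}$ on $\mathbb{Y}$, non-negative coefficients $a_j,b_j,c_j$ ($j\in J$) and $\beta$ with $\sum_j a_j=\sum_j b_j=\beta+\sum_j c_j=1$, and for each $x\in\mathbb{X}$ a left-over probability distribution $\mathrm{LO}(x)$ (arbitrary if $\beta=0$), such that $\mathcal{R}(u)=\sum_j a_jQ^j$, $\mathcal{R}(\bar u)=\sum_j b_jQ^j$, and $\mathcal{R}(x)=\sum_j c_jQ^j+\beta\,\mathrm{LO}(x)$ for all $x\in\mathbb{X}$. Reduction pair: let $A_0,A_1,A_2$ be distributions on $J\cup\{\bot\}$ with $\Pr[A_0=j]=a_j$, $\Pr[A_1=j]=b_j$, $\Pr[A_2=j]=c_j$ for $j\in J$, $\Pr[A_0=\bot]=\Pr[A_1=\bot]=0$, $\Pr[A_2=\bot]=\beta$. For $a\in\{0,1\}$, $P_a^{\mathsf{GC}}$ is the distribution of the histogram of $n$ independent samples, one from $A_a$ and $n-1$ from $A_2$, where $n\geq 1$ is the number of users. Privacy blanket reduction pair: $\gamma=\sum_y\inf_x\mathcal{R}(x)(y)$, $\omega(y)=\inf_x\mathcal{R}(x)(y)/\gamma$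 ($\omega$ arbitrary if $\gamma=0$). $P_0^{\mathsf{B}}$ (resp. $P_1^{\mathsf{B}}$) is the distribution of $(M,Y_M)$ with $M\sim\mathrm{Bin}(n-1,\gamma)$ and, given $M$, $Y_M$ the multiset consisting of one sample from $\mathcal{R}(u)$ (resp. $\mathcal{R}(\bar u)$) and $M$ independent samples from $\omega$. Optimal decomposition: a general clone decomposition equivalent to the privacy blanket framework, i.e. for every $n\ge1$ there are (possibly randomized) functions $f,g$ with $f(P_a^{\mathsf{B}})=P_a^{\mathsf{GC}}$ and $g(P_a^{\mathsf{GC}})=P_a^{\mathsf{B}}$ in distribution for both $a=0,1$. Primary optimal decomposition of $\mathcal{R}$ with respect to $(u,\bar u)$: $J=\mathbb{Y}$, $Q^y=\mathbb{1}_y$ (point mass), $a_y=\mathcal{R}(u)(y)$, $b_y=\mathcal{R}(\bar u)(y)$, $c_y=\inf_x\mathcal{R}(x)(y)$, $\beta=1-\sum_y c_y$. Simplified optimal decomposition (for $\mathcal{R}$ with $\inf_x\mathcal{R}(x)(y)>0$ for all $y$; this is assumed of every $\mathcal{R}_i$ in the simplified case): with $S_{r_0,r_1}=\{y:\mathcal{R}(u)(y)=r_0\inf_x\mathcal{R}(x)(y),\ \mathcal{R}(\bar u)(y)=r_1\inf_x\mathcal{R}(x)(y)\}$, $J$ is the set of $(r_0,r_1)$ with $S_{r_0,r_1}\ne\emptyset$, $a_{r_0,r_1}=\sum_{y\in S_{r_0,r_1}}\mathcal{R}(u)(y)$, $b_{r_0,r_1}=\sum_{y\in S_{r_0,r_1}}\mathcal{R}(\bar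 u)(y)$, $c_{r_0,r_1}=\sum_{y\in S_{r_0,r_1}}\inf_x\mathcal{R}(x)(y)$, $Q^{r_0,r_1}(y)=\mathcal{R}(u)(y)/a_{r_0,r_1}$ on $S_{r_0,r_1}$ and $0$ elsewhere, $\beta=1-\sum c_{r_0,r_1}$. Cartesian product of decompositions: given decompositions of $\mathcal{R}_i$ with data $(J_i,Q^{(i),j},a^{(i)}_j,b^{(i)}_j,c^{(i)}_j,\beta_i,\mathrm{LO}_i)$, their Cartesian product is obtained by expanding the product distributions $\prod_i\big(\sum_j a^{(i)}_jQ^{(i),j}\big)$, $\prod_i\big(\sum_j b^{(i)}_jQ^{(i),j}\big)$, $\prod_i\big(\sum_j c^{(i)}_jQ^{(i),j}+\beta_i\mathrm{LO}_i(x^i)\big)$ (product measures): its components are indexed by $(j_1,\dots,j_m)\in J_1\times\cdots\times J_m$, with distribution $Q^{(1),j_1}\times\cdots\times Q^{(m),j_m}$ and coefficients $\prod_i a^{(i)}_{j_i}$, $\prod_i b^{(i)}_{j_i}$, $\prod_i c^{(i)}_{j_i}$; all terms involving at least one $\mathrm{LO}_i$ are merged into a single left-over distribution of weight $\beta=1-\prod_i(1-\beta_i)$. *)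

(* Defs.v *)
From HB Require Import structures.
From mathcomp Require Import all_boot all_order all_algebra.
From mathcomp Require Import classical_sets reals.

Set Implicit Arguments.
Unset Strict Implicit.
Unset Printing Implicit Defensive.
Import Order.TTheory GRing.Theory Num.Theory.
Local Open Scope ring_scope.

Definition is_dist (K : realType) (T : finType) (p : T -> K) : Prop :=
  (forall t, 0 <= p t) /\ \sum_t p t = 1.

(* Randomized maps, local randomizers included: [k s] is the output law on
   input [s]. *)
Definition is_kernel (K : realType) (S : Type) (T : finType)
    (k : S -> T -> K) : Prop :=
  forall s, is_dist (k s).

Definition push (K : realType) (S T : finType) (k : S -> T -> K) (p : S -> K)
    (t : T) : K :=
  \sum_s p s * k s t.

Definition joint (K : realType) (m : nat) (X : 'I_m -> Type)
    (Y : 'I_m -> finType) (R : forall i, X i -> Y i -> K)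
    (x : forall i, X i) (y : {dffun forall i : 'I_m, Y i}) : K :=
  \prod_i R i (x i) (y i).

Definition infR (K : realType) (X : Type) (Y : finType) (R : X -> Y -> K)
    (y : Y) : K :=
  inf (range (fun x => R x y)).

(* Multisets over [T] with at most [N] elements are encoded by their counts;
   [inord] does not truncate as long as [size s <= N], which holds at every use
   below. *)
Definition hist (N : nat) (T : finType) (s : seq T) : {ffun T -> 'I_N.+1} :=
  [ffun t => inord (count_mem t s)].

(* Law of the histogram of one sample from [p] and [k] samples from [q], all
   independent. *)
Definition hist_law (K : realType) (N : nat) (T : finType) (p q : T -> K)
    (k : nat) (h : {ffun T -> 'I_N.+1}) : K :=
  \sum_(z : T) \sum_(w : k.-tuple T | hist N (z :: w) == h)
     p z * \prod_(v <- w) q v.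

(* [cA], [cB], [cC], [cBeta] are the coefficients a, b, c, beta. *)
Record clone_data (K : realType) (X : Type) (Y : finType) := CloneData {
  cJ : finType;
  cQ : cJ -> Y -> K;
  cA : cJ -> K;
  cB : cJ -> K;
  cC : cJ -> K;
  cBeta : K;
  cLO : X -> Y -> K }.

Record is_clone_decomp (K : realType) (X : Type) (Y : finType)
    (R : X -> Y -> K) (u ubar : X) (D : clone_data K X Y) : Prop :=
  IsCloneDecomp {
  cQ_dist : is_kernel (@cQ _ _ _ D);
  cA_ge0 : forall j : cJ D, 0 <= cA j;
  cB_ge0 : forall j : cJ D, 0 <= cB j;
  cC_ge0 : forall j : cJ D, 0 <= cC j;
  cBeta_ge0 : 0 <= cBeta D;
  cA_sum : \sum_(j : cJ D) cA j = 1;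
  cB_sum : \sum_(j : cJ D) cB j = 1;
  cC_sum : cBeta D + \sum_(j : cJ D) cC j = 1;
  cLO_dist : is_kernel (cLO D);
  cA_eq : forall y, R u y = \sum_(j : cJ D) cA j * cQ j y;
  cB_eq : forall y, R ubar y = \sum_(j : cJ D) cB j * cQ j y;
  cC_eq : forall x y,
    R x y = \sum_(j : cJ D) cC j * cQ j y + cBeta D * cLO D x y }.

(* The laws A_0, A_1, A_2 on J + {bot}, with bot encoded as [None]; the bit
   selects A_0 ([false]) or A_1 ([true]). *)
Definition gcA01 (K : realType) (X : Type) (Y : finType)
    (D : clone_data K X Y) (a : bool) (o : option (cJ D)) : K :=
  if o is Some j then (if a then cB j else cA j) else 0.

Definition gcA2 (K : realType) (X : Type) (Y : finType)
    (D : clone_data K X Y) (o : option (cJ D)) : K :=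
  if o is Some j then cC j else cBeta D.

Definition PGC (K : realType) (X : Type) (Y : finType) (D : clone_data K X Y)
    (n : nat) (a : bool) : {ffun option (cJ D) -> 'I_n.+1} -> K :=
  hist_law (gcA01 a) (@gcA2 _ _ _ D) n.-1.

Definition gammaB (K : realType) (X : Type) (Y : finType) (R : X -> Y -> K) : K :=
  \sum_y infR R y.

(* When gamma = 0 the blanket law is arbitrary (no sample of it is ever drawn);
   the uniform law is used. *)
Definition omegaB (K : realType) (X : Type) (Y : finType) (R : X -> Y -> K)
    (y : Y) : K :=
  if gammaB R == 0 then #|Y|%:R^-1 else infR R y / gammaB R.

(* Law of (M, Y_M), with M <= n - 1 and Y_M of size M + 1 <= n. *)
Definition PB (K : realType) (X : Type) (Y : finType) (R : X -> Y -> K)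
    (u ubar : X) (n : nat) (a : bool)
    (s : 'I_n * {ffun Y -> 'I_n.+1}) : K :=
  'C(n.-1, s.1)%:R * gammaB R ^+ s.1 * (1 - gammaB R) ^+ (n.-1 - s.1)
  * hist_law (R (if a then ubar else u)) (omegaB R) s.1 s.2.

Definition is_optimal_decomp (K : realType) (X : Type) (Y : finType)
    (R : X -> Y -> K) (u ubar : X) (D : clone_data K X Y) : Prop :=
  is_clone_decomp R u ubar D /\
  forall n : nat, (0 < n)%N ->
    exists (f : 'I_n * {ffun Y -> 'I_n.+1} ->
                {ffun option (cJ D) -> 'I_n.+1} -> K)
           (g : {ffun option (cJ D) -> 'I_n.+1} ->
                'I_n * {ffun Y -> 'I_n.+1} -> K),
      [/\ is_kernel f, is_kernel g &
          forall a : bool,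
            push f (PB R u ubar a) =1 PGC a /\
            push g (PGC a) =1 PB R u ubar (n := n) a].

(* The left-over law forced by R(x) = sum_j c_j Q^j + beta LO(x); it is arbitrary
   when beta = 0, where R(x) itself is used. *)
Definition leftover (K : realType) (X : Type) (Y J : finType) (R : X -> Y -> K)
    (Q : J -> Y -> K) (c : J -> K) (beta : K) (x : X) (y : Y) : K :=
  if beta == 0 then R x y else (R x y - \sum_j c j * Q j y) / beta.

Definition primary (K : realType) (X : Type) (Y : finType) (R : X -> Y -> K)
    (u ubar : X) : clone_data K X Y :=
  let Q := fun j y : Y => (y == j)%:R in
  let c := infR R in
  let beta := 1 - \sum_y c y in
  {| cJ := Y; cQ := Q; cA := R u; cB := R ubar; cC := c; cBeta := beta;
     cLO := leftover R Q c beta |}.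

Definition classS (K : realType) (X : Type) (Y : finType) (R : X -> Y -> K)
    (u ubar : X) (r : K * K) : {set Y} :=
  [set y | (R u y == r.1 * infR R y) && (R ubar y == r.2 * infR R y)].

Definition ratios (K : realType) (X : Type) (Y : finType) (R : X -> Y -> K)
    (u ubar : X) : seq (K * K) :=
  [seq (R u y / infR R y, R ubar y / infR R y) | y : Y].

(* Under the positivity assumption of the simplified case, [ratios] enumerates
   exactly the (r0, r1) with S_{r0,r1} nonempty. *)
Lemma mem_ratios (K : realType) (X : Type) (Y : finType) (R : X -> Y -> K)
    (u ubar : X) (r : K * K) :
  (forall y, 0 < infR R y) ->
  (r \in ratios R u ubar) = (classS R u ubar r != finset.set0).
Proof.
move=> pos; have nz y : infR R y != 0 by rewrite gt_eqF.
apply/mapP/set0Pn => [[y _ ->]|[y]].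
  by exists y; rewrite inE /= !divfK ?eqxx.
rewrite inE => /andP[/eqP e0 /eqP e1]; exists y; first by rewrite mem_enum.
by rewrite e0 e1 !mulfK //; case: r {e0 e1}.
Qed.

Definition simplified (K : realType) (X : Type) (Y : finType) (R : X -> Y -> K)
    (u ubar : X) : clone_data K X Y :=
  let J : finType := seq_sub (ratios R u ubar) in
  let S := fun j : J => classS R u ubar (val j) in
  let a := fun j => \sum_(y in S j) R u y in
  let b := fun j => \sum_(y in S j) R ubar y in
  let c := fun j => \sum_(y in S j) infR R y in
  let Q := fun j y => if y \in S j then R u y / a j else 0 in
  let beta := 1 - \sum_j c j in
  {| cJ := J; cQ := Q; cA := a; cB := b; cC := c; cBeta := beta;
     cLO := leftover R Q c beta |}.

(* The left-over law collects the terms of the expansion indexed by the nonempty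
   sets [S] of coordinates on which LO_i is selected; when the total left-over
   weight is 0 it is arbitrary, and the product of the LO_i is used. *)
Definition cartesian (K : realType) (m : nat) (X : 'I_m -> Type)
    (Y : 'I_m -> finType) (D : forall i, clone_data K (X i) (Y i)) :
    clone_data K (forall i, X i) {dffun forall i : 'I_m, Y i} :=
  let J : finType := {dffun forall i : 'I_m, cJ (D i)} in
  let beta := 1 - \prod_i (1 - cBeta (D i)) in
  {| cJ := J;
     cQ := fun (j : J) (y : {dffun forall i : 'I_m, Y i}) =>
       \prod_i cQ (j i) (y i);
     cA := fun j : J => \prod_i cA (j i);
     cB := fun j : J => \prod_i cB (j i);
     cC := fun j : J => \prod_i cC (j i);
     cBeta := beta;
     cLO := fun x (y : {dffun forall i : 'I_m, Y i}) =>
       if beta == 0 then \prod_i cLO (D i) (x i) (y i) else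
       (\sum_(S : {set 'I_m} | S != finset.set0) \prod_i
          (if i \in S then cBeta (D i) * cLO (D i) (x i) (y i)
           else \sum_(j : cJ (D i)) cC j * cQ j (y i))) / beta |}.

(* Main.v *)
(* All these decompositions have the same shape: the supports of the Q^j
   partition Y into the fibres of a map pi : Y -> J, and
   inf_x R(x) = sum_j c_j Q^j. Then R(u), R(ubar) and inf_x R(x) are mixtures of
   the same Q^j, so pi is a sufficient statistic, whose inverse channel is
   j |-> Q^j. A channel acting on single samples lifts to histograms, because
   the law of the image histogram only depends on the input histogram; so P^GC
   is equivalent to the same experiment on Y + {bot}, where n - 1 users sample y
   with probability inf_x R(x)(y) and bot otherwise. Counting the bots is a
   bijection between its histograms and the pairs (M, Y_M), M being binomial.
   The shape is stable under Cartesian products, since the infimum of a product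
   of non-negative functions of independent variables is the product of the
   infima. *)

Require Import Defs.
From mathcomp Require Import all_boot all_order all_algebra.
From mathcomp Require Import classical_sets boolp reals.

Set Implicit Arguments.
Unset Strict Implicit.
Unset Printing Implicit Defensive.
Import Order.TTheory GRing.Theory Num.Theory.
Local Open Scope ring_scope.

(** * Finite sums *)

Lemma sum_mulb_eq (K : nzRingType) (T : finType) (t0 : T) (F : T -> K) :
  \sum_t F t * (t == t0)%:R = F t0.
Proof.
rewrite (bigD1 t0) //= eqxx mulr1 big1 ?addr0 // => t /negPf ->.
by rewrite mulr0.
Qed.

Lemma sum_tuple_cons (V : nmodType) (T : finType) (k : nat)
    (F : k.+1.-tuple T -> V) :
  \sum_w F w = \sum_z \sum_(w : k.-tuple T) F [tuple of z :: w].
Proof.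
rewrite pair_big /=.
rewrite (reindex (fun zw : T * k.-tuple T => [tuple of zw.1 :: zw.2])) //=.
exists (fun w => (thead w, [tuple of behead w])) => [[z w]|w] _ /=.
  by congr pair; apply: val_inj.
by rewrite -tuple_eta.
Qed.

Lemma sum_option (V : nmodType) (T : finType) (F : option T -> V) :
  \sum_o F o = F None + \sum_t F (Some t).
Proof.
rewrite (bigD1 None) //=; congr (_ + _).
rewrite (reindex_omap some id) /=; last by case.
by apply: eq_bigl => t; rewrite eqxx.
Qed.

(** * Kernels and their action on laws *)

Section Kernels.

Variable K : realType.

Lemma is_kernel_dirac (S : Type) (T : finType) (f : S -> T) :
  is_kernel (fun s t => (t == f s)%:R : K).
Proof.
move=> s; split=> [t|]; first exact: ler0n.
rewrite -[RHS](sum_mulb_eq (f s) (fun=> 1)).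
by under [RHS]eq_bigr do rewrite mul1r.
Qed.

Definition kcomp (S T U : finType) (k : S -> T -> K) (l : T -> U -> K)
    (s : S) : U -> K :=
  push l (k s).

Lemma push_dist (S T : finType) (k : S -> T -> K) (p : S -> K) :
  is_kernel k -> is_dist p -> is_dist (push k p).
Proof.
move=> hk [p0 p1]; split=> [t|].
  by apply: sumr_ge0 => s _; rewrite mulr_ge0 // (hk s).1.
rewrite exchange_big -[RHS]p1; apply: eq_bigr => s _.
by rewrite -mulr_sumr (hk s).2 mulr1.
Qed.

Lemma push_kcomp (S T U : finType) (k : S -> T -> K) (l : T -> U -> K)
    (p : S -> K) :
  push (kcomp k l) p =1 push l (push k p).
Proof.
move=> u; rewrite /push /kcomp /push.
under eq_bigr do rewrite mulr_sumr.
rewrite exchange_big; apply: eq_bigr => t _.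
by rewrite mulr_suml; apply: eq_bigr => s _; rewrite mulrA.
Qed.

Lemma eq_push (S T : finType) (k : S -> T -> K) (p q : S -> K) :
  p =1 q -> push k p =1 push k q.
Proof. by move=> pq t; apply: eq_bigr => s _; rewrite pq. Qed.

(** As [q] vanishes off the image of the injection [f], nothing is lost when [f] is inverted by [g].
    This converts a relabelling of outcomes into a pair of deterministic channels. *)
Lemma push_dirac_section (S T : finType) (f : S -> T) (g : T -> S)
    (p : S -> K) (q : T -> K) :
  cancel f g -> (forall s, p s = q (f s)) ->
  (forall t, q t != 0 -> f (g t) = t) ->
  push (fun s t => (t == f s)%:R) p =1 q /\
  push (fun t s => (s == g t)%:R) q =1 p.
Proof.
move=> fK pq qsupp; split=> [t|s]; rewrite /push.
  have [q0|/qsupp tE] := eqVneq (q t) 0.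
    rewrite q0 big1 // => s _; have [tE|_] := eqVneq t (f s).
      by rewrite pq -tE q0 mul0r.
    by rewrite mulr0.
  rewrite (bigD1 (g t)) //= tE eqxx mulr1 pq tE big1 ?addr0 // => s sg.
  have [tf|_] := eqVneq t (f s); last by rewrite mulr0.
  by rewrite tf fK eqxx in sg.
rewrite (bigD1 (f s)) //= fK eqxx mulr1 pq big1 ?addr0 // => t tf.
have [->|/qsupp tE] := eqVneq (q t) 0; first by rewrite mul0r.
have [sE|_] := eqVneq s (g t); last by rewrite mulr0.
by rewrite sE tE eqxx in tf.
Qed.

End Kernels.

(** * Independent samples and their histograms *)

Section Expectation.

Variable K : realType.

(** Expectation of [phi] over independent samples, one from each law of the list. A list lets the
    distinguished user have a law of its own, and opens everything to structural induction. *)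
Fixpoint expect (T : finType) (ps : seq (T -> K)) (phi : seq T -> K) : K :=
  if ps is p :: ps' then \sum_t p t * expect ps' (fun s => phi (t :: s))
  else phi [::].

Lemma eq_expect (T : finType) (ps : seq (T -> K)) (phi psi : seq T -> K) :
  (forall s, size s = size ps -> phi s = psi s) ->
  expect ps phi = expect ps psi.
Proof.
elim: ps phi psi => [|p ps IH] phi psi /= H; first exact: H.
apply: eq_bigr => t _; congr (_ * _); apply: IH => s hs.
by apply: H; rewrite /= hs.
Qed.

Lemma expect_sum (T I : finType) (ps : seq (T -> K)) (phi : I -> seq T -> K) :
  expect ps (fun s => \sum_i phi i s) = \sum_i expect ps (phi i).
Proof.
elim: ps phi => [//|p ps IH] phi /=.
rewrite exchange_big; apply: eq_bigr => t _.
by rewrite (IH (fun i s => phi i (t :: s))) mulr_sumr.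
Qed.

Lemma expectZ (T : finType) (c : K) (ps : seq (T -> K)) (phi : seq T -> K) :
  expect ps (fun s => c * phi s) = c * expect ps phi.
Proof.
elim: ps phi => [//|p ps IH] phi /=.
rewrite mulr_sumr; apply: eq_bigr => t _.
by rewrite (IH (fun s => phi (t :: s))) mulrCA.
Qed.

Lemma expectZr (T : finType) (c : K) (ps : seq (T -> K)) (phi : seq T -> K) :
  expect ps (fun s => phi s * c) = expect ps phi * c.
Proof.
rewrite mulrC -expectZ; apply: eq_expect => s _; exact: mulrC.
Qed.

Lemma expect1 (S T : finType) (k : S -> T -> K) (s : seq S) :
  is_kernel k -> expect (map k s) (fun=> 1) = 1.
Proof.
move=> hk; elim: s => [//|x s IH] /=.
by rewrite IH; under eq_bigr do rewrite mulr1; rewrite (hk x).2.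
Qed.

Lemma expect_map_ge0 (S T : finType) (k : S -> T -> K) (s : seq S)
    (phi : seq T -> K) :
  is_kernel k -> (forall s, 0 <= phi s) -> 0 <= expect (map k s) phi.
Proof.
move=> hk; elim: s phi => [|x s IH] phi phi0 /=; first exact: phi0.
by apply: sumr_ge0 => t _; rewrite mulr_ge0 ?(hk x).1 ?IH.
Qed.

(** Drawing the samples and then passing each one through [k] amounts to drawing from the pushed
    laws: the sums over intermediate values factor coordinate by coordinate. *)
Lemma expect_comp (S T : finType) (k : S -> T -> K) (ps : seq (S -> K))
    (phi : seq T -> K) :
  expect ps (fun s => expect (map k s) phi) = expect (map (push k) ps) phi.
Proof.
elim: ps phi => [//|p ps IH] phi /=.
under eq_bigr do rewrite expect_sum mulr_sumr.
rewrite exchange_big; apply: eq_bigr => t _; rewrite /push mulr_suml.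
apply: eq_bigr => s _.
by rewrite expectZ (IH (fun s => phi (t :: s))) mulrA.
Qed.

Lemma expect_cat (T : finType) (ps qs : seq (T -> K)) (phi : seq T -> K) :
  expect (ps ++ qs) phi =
  expect ps (fun s => expect qs (fun t => phi (s ++ t))).
Proof.
elim: ps phi => [//|p ps IH] phi /=.
by apply: eq_bigr => t _; rewrite (IH (fun s => phi (t :: s))).
Qed.

Lemma exchange_expect (S T : finType) (ps : seq (S -> K)) (qs : seq (T -> K))
    (phi : seq S -> seq T -> K) :
  expect ps (fun s => expect qs (phi s)) =
  expect qs (fun t => expect ps (phi^~ t)).
Proof.
elim: ps phi => [//|p ps IH] phi /=.
rewrite expect_sum; apply: eq_bigr => t _.
by rewrite expectZ (IH (fun s => phi (t :: s))).
Qed.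

(** Permutations are generated by swaps of adjacent blocks, and independent blocks are swapped by
    exchanging the order of summation. *)
Lemma perm_expect (S T : finType) (k : S -> T -> K) (s1 s2 : seq S)
    (phi : seq T -> K) :
  (forall t1 t2, perm_eq t1 t2 -> phi t1 = phi t2) ->
  perm_eq s1 s2 -> expect (map k s1) phi = expect (map k s2) phi.
Proof.
move=> hphi; apply: (@catCA_perm_subst _ _ (fun s => expect (map k s) phi)).
move=> {}s1 {}s2 s3.
rewrite !map_cat !expect_cat.
under eq_expect do rewrite expect_cat.
under [RHS]eq_expect do rewrite expect_cat.
rewrite exchange_expect; apply: eq_expect => t2 _; apply: eq_expect => t1 _.
by apply: eq_expect => t3 _; apply: hphi; rewrite perm_catCA.
Qed.

Lemma expect_nseq_tuple (T : finType) (q : T -> K) (k : nat)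
    (phi : seq T -> K) :
  expect (nseq k q) phi =
  \sum_(w : k.-tuple T) (\prod_(v <- w) q v) * phi w.
Proof.
elim: k phi => [|k IH] phi /=.
  rewrite (big_pred1 [tuple]) => [|w]; last first.
    by apply/esym/eqP/val_inj; rewrite tuple0.
  by rewrite /= big_nil mul1r.
rewrite sum_tuple_cons; apply: eq_bigr => z _; rewrite IH mulr_sumr.
by apply: eq_bigr => w _; rewrite big_cons mulrA.
Qed.

Lemma hist_lawE (N : nat) (T : finType) (p q : T -> K) (k : nat)
    (h : {ffun T -> 'I_N.+1}) :
  hist_law p q k h = expect (p :: nseq k q) (fun s => (hist N s == h)%:R).
Proof.
rewrite /hist_law /=; apply: eq_bigr => z _.
rewrite expect_nseq_tuple mulr_sumr big_mkcond.
apply: eq_bigr => w _ /=.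
by case: (_ == _); rewrite ?mulr1 ?mulr0.
Qed.


Lemma expect_nseqZ (T : finType) (c : K) (p q : T -> K)
    (k : nat) (phi : seq T -> K) :
  (forall t, p t = c * q t) ->
  expect (nseq k p) phi = c ^+ k * expect (nseq k q) phi.
Proof.
move=> pq; elim: k phi => [|k IH] phi /=; first by rewrite mul1r.
rewrite mulr_sumr; apply: eq_bigr => t _; rewrite IH pq exprS.
by rewrite mulrACA.
Qed.

(* Condition on the positions where [None] is drawn; the sum satisfies Pascal's
   recurrence. *)
Lemma expect_pmap (T : finType) (q : option T -> K) (k : nat)
    (phi : seq T -> K) :
  expect (nseq k q) (fun s => phi (pmap id s)) =
  \sum_(i < k.+1) 'C(k, i)%:R * q None ^+ (k - i)
     * expect (nseq i (q \o some)) phi.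
Proof.
elim: k phi => [|k IH] phi; first by rewrite big_ord1 /= bin0 !mul1r.
have -> : expect (nseq k.+1 q) (fun s => phi (pmap id s)) =
    q None * expect (nseq k q) (fun s => phi (pmap id s)) +
    \sum_t q (Some t) * expect (nseq k q) (fun s => phi (t :: pmap id s)).
  by rewrite /= sum_option.
have -> : \sum_t q (Some t) *
      expect (nseq k q) (fun s => phi (t :: pmap id s)) =
    \sum_(i < k.+1) 'C(k, i)%:R * q None ^+ (k - i)
       * expect (nseq i.+1 (q \o some)) phi.
  have E t : q (Some t) * expect (nseq k q) (fun s => phi (t :: pmap id s)) =
      \sum_(i < k.+1) 'C(k, i)%:R * q None ^+ (k - i) *
        (q (Some t) * expect (nseq i (q \o some)) (fun s => phi (t :: s))).
    rewrite (IH (fun s => phi (t :: s))) mulr_sumr.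
    by apply: eq_bigr => i _; rewrite mulrCA.
  under eq_bigr do rewrite E.
  by rewrite exchange_big /=; apply: eq_bigr => i _; rewrite mulr_sumr.
rewrite IH.
rewrite mulr_sumr big_ord_recl [RHS]big_ord_recl /= !bin0 !subn0 !mul1r.
rewrite mulrA -exprS -addrA; congr (_ + _).
(* Pascal's rule splits the sum in two: one half is the contribution of a first draw different from
   [None]; the other, whose last binomial is zero, is that of a first draw [None]. *)
under [RHS]eq_bigr => i _ do
  rewrite /bump /= add1n binS subSS natrD !mulrDl.
rewrite big_split /= [X in _ = X + _]big_ord_recr /= bin_small // !mul0r addr0.
congr (_ + _); apply: eq_bigr => i _; rewrite /bump /= add1n.
by rewrite mulrA [q None * _]mulrCA -exprS subnSK.
Qed.

Lemma perm_hist (N : nat) (T : finType) (s t : seq T) :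
  perm_eq s t -> hist N s = hist N t.
Proof. by move/permP => st; apply/ffunP => x; rewrite !ffunE st. Qed.

Lemma hist_perm (N : nat) (T : finType) (s t : seq T) :
  (size s <= N)%N -> (size t <= N)%N -> hist N s = hist N t -> perm_eq s t.
Proof.
move=> hs ht /ffunP E; apply/allP => x _; apply/eqP.
have /(congr1 val) := E x; rewrite !ffunE /= !inordK ?ltnS //.
  exact: leq_trans (count_size _ _) ht.
exact: leq_trans (count_size _ _) hs.
Qed.

(** An ordering of the multiset [h], determined up to permutation. Counts that come from no
    [N]-tuple get the empty sequence, which keeps [hist_kernel] a kernel on every input. *)
Definition hist_repr (N : nat) (T : finType) (h : {ffun T -> 'I_N.+1}) :
    seq T :=
  oapp (@tval N T) [::] [pick t : N.-tuple T | hist N t == h].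

Lemma perm_hist_repr (N : nat) (T : finType) (s : seq T) :
  size s = N -> perm_eq (hist_repr (hist N s)) s.
Proof.
move=> <-; rewrite /hist_repr; case: pickP => [t /eqP tE|/(_ (in_tuple s))].
  by apply: (@hist_perm (size s)) => //; rewrite (size_tuple t).
by rewrite /= eqxx.
Qed.

(** The lift of a single-sample channel to histograms: order the multiset arbitrarily, apply [k]
    independently to each entry, and forget the order again. *)
Definition hist_kernel (N : nat) (S T : finType) (k : S -> T -> K)
    (h : {ffun S -> 'I_N.+1}) (h' : {ffun T -> 'I_N.+1}) : K :=
  expect (map k (hist_repr h)) (fun s => (hist N s == h')%:R).

Lemma sum_dirac (T : finType) (t0 : T) : \sum_t (t0 == t)%:R = 1 :> K.
Proof.
rewrite -[RHS](sum_mulb_eq t0 (fun=> 1)).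
by apply: eq_bigr => t _; rewrite mul1r eq_sym.
Qed.

Lemma is_kernel_hist (N : nat) (S T : finType) (k : S -> T -> K) :
  is_kernel k -> is_kernel (@hist_kernel N S T k).
Proof.
move=> hk h; split=> [h'|]; first by apply: expect_map_ge0.
rewrite -expect_sum -[RHS](expect1 (hist_repr h) hk).
by apply: eq_expect => s _; exact: sum_dirac.
Qed.

(** The ordering picked by [hist_repr] is a permutation of the drawn samples, and the expectation
    does not see permutations; [expect_comp] then moves [k] into the laws. *)
Lemma push_hist (N : nat) (S T : finType) (k : S -> T -> K) (p q : S -> K) :
  push (@hist_kernel N.+1 S T k) (hist_law p q N) =1
  hist_law (push k p) (push k q) N.
Proof.
move=> h'; rewrite /push.
under eq_bigr do rewrite hist_lawE -expectZr.
rewrite -expect_sum hist_lawE.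
have -> : push k p :: nseq N (push k q) = map (push k) (p :: nseq N q).
  by rewrite /= map_nseq.
rewrite -expect_comp; apply: eq_expect => s /= hs.
under eq_bigr do rewrite mulrC eq_sym.
rewrite sum_mulb_eq; apply: perm_expect => [t1 t2 t12|].
  by rewrite (perm_hist _ t12).
by apply: perm_hist_repr; rewrite hs size_nseq.
Qed.

End Expectation.

(** * Blanket pairs as histograms with bots *)

Section Blanket.

Variables (K : realType) (Y : finType) (k : nat).

(** Here [k] is n - 1, the number of other users; those that contribute no blanket sample are
    counted at [None], so M is recovered from that count. *)
Definition blanket_hist (s : 'I_k.+1 * {ffun Y -> 'I_k.+2}) :
    {ffun option Y -> 'I_k.+2} :=
  [ffun o => if o is Some y then s.2 y else inord (k - s.1)].

Definition hist_blanket (h : {ffun option Y -> 'I_k.+2}) :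
    'I_k.+1 * {ffun Y -> 'I_k.+2} :=
  (inord (k - h None), [ffun y => h (Some y)]).

Lemma blanket_histK : cancel blanket_hist hist_blanket.
Proof.
case=> i h; rewrite /hist_blanket !ffunE; congr pair; last first.
  by apply/ffunP => y; rewrite !ffunE.
have ik : (i <= k)%N by rewrite -ltnS.
have ki : (k - i < k.+2)%N by rewrite ltnS leqW ?leq_subr.
by apply: val_inj; rewrite /= (inordK ki) subKn // inordK.
Qed.

Lemma hist_blanketK (h : {ffun option Y -> 'I_k.+2}) :
  (h None <= k)%N -> blanket_hist (hist_blanket h) = h.
Proof.
move=> hk; apply/ffunP => -[y|]; rewrite !ffunE //=.
have kh : (k - h None < k.+1)%N by rewrite ltnS leq_subr.
by rewrite (inordK kh) subKn // inord_val.
Qed.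

Lemma hist_blanketE (y : Y) (s : seq (option Y)) (i : 'I_k.+1)
    (h : {ffun Y -> 'I_k.+2}) :
  size s = k ->
  (hist k.+1 (Some y :: s) == blanket_hist (i, h)) =
  (size (pmap id s) == i) && (hist k.+1 (y :: pmap id s) == h).
Proof.
move=> sk.
have cN : count_mem None s = (k - size (pmap id s))%N.
  rewrite size_pmap -sk -(count_predC isSome) addKn.
  by apply: eq_count; case.
have cS y' : count_mem (Some y') s = count_mem y' (pmap id s).
  by elim: s {sk cN} => //= -[z|] s -> //=; rewrite add0n.
have szk : (size (pmap id s) <= k)%N by rewrite size_pmap -sk count_size.
have ik : (i <= k)%N by rewrite -ltnS.
apply/eqP/andP => [/ffunP E|[/eqP si /eqP <-]].
  split; apply/eqP.
    have /(congr1 val) := E None; rewrite !ffunE /= add0n cN.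
    rewrite !inordK ?ltnS; try by rewrite (leq_trans (leq_subr _ _)).
    by move=> /(congr1 (subn k)); rewrite !subKn.
  by apply/ffunP => y'; have := E (Some y'); rewrite !ffunE /= cS => <-.
by apply/ffunP => -[y'|]; rewrite !ffunE /= ?cS // add0n cN si.
Qed.

(** Conditioning on the number of samples different from [None] produces the binomial weight; the
    factor [g ^+ s.1] is what normalises the sub-probability [c] into [w] on those samples. *)
Lemma hist_law_blanket (r c w : Y -> K) (g : K)
    (s : 'I_k.+1 * {ffun Y -> 'I_k.+2}) :
  (forall y, c y = g * w y) ->
  'C(k, s.1)%:R * g ^+ s.1 * (1 - g) ^+ (k - s.1) * hist_law r w s.1 s.2 =
  hist_law (oapp r 0) (oapp c (1 - g)) k (blanket_hist s).
Proof.
case: s => i h /= cw; rewrite !hist_lawE /= sum_option /= mul0r add0r mulr_sumr.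
apply: eq_bigr => y _; rewrite mulrCA; congr (_ * _).
pose phi t := (size t == i)%:R * (hist k.+1 (y :: t) == h)%:R : K.
transitivity (expect (nseq k (oapp c (1 - g))) (fun t => phi (pmap id t))).
  (* Only the term with exactly [i] samples different from [None] passes the size test in [phi]. *)
  rewrite expect_pmap /= (bigD1 i) //= [X in _ = _ + X]big1 ?addr0.
    rewrite (expect_nseqZ _ _ cw) [RHS]mulrA -!mulrA; congr (_ * _).
    rewrite mulrCA; congr (_ * (_ * _)).
    apply: eq_expect => t; rewrite size_nseq => ti.
    by rewrite /phi ti eqxx mul1r.
  move=> j ji; rewrite [X in _ * X](_ : _ = 0) ?mulr0 //.
  (* The zero function is written as a product so that [expectZ] can pull the factor 0 out. *)
  rewrite (@eq_expect _ _ _ _ (fun=> 0 * 0)) ?expectZ ?mul0r // => t.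
  rewrite size_nseq /phi => ->; rewrite -val_eqE in ji.
  by rewrite (negPf ji) !mul0r.
apply: eq_expect => t; rewrite size_nseq => tk.
by rewrite hist_blanketE // /phi -natrM mulnb.
Qed.

(** The distinguished sample is never [None], so at most the [k] others are. This rules out the
    count [k.+1], at which the subtraction in [hist_blanket] truncates. *)
Lemma hist_law_None (r : Y -> K) (q : option Y -> K)
    (h : {ffun option Y -> 'I_k.+2}) :
  hist_law (oapp r 0) q k h != 0 -> (h None <= k)%N.
Proof.
apply: contraNT; rewrite -ltnNge => hk; apply/eqP.
rewrite hist_lawE /= sum_option /= mul0r add0r big1 // => y _.
rewrite (@eq_expect _ _ _ _ (fun=> 0 * 0)) ?expectZ ?mul0r ?mulr0 // => s.
rewrite size_nseq => sk; case: eqP => hE; last by rewrite ?mul0r.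
move: hk.
have csk : (count_mem None s <= k)%N by rewrite -sk count_size.
by rewrite -hE ffunE /= add0n inordK ?ltnS ?leqW // ltnNge csk.
Qed.

End Blanket.

(** * Optimality from a partition of the outputs *)

Section Optimality.

Variables (K : realType) (X : Type) (Y : finType) (R : X -> Y -> K).
Variables (u ubar : X) (hR : is_kernel R).

Lemma infR_le (x : X) (y : Y) : infR R y <= R x y.
Proof.
apply: ge_inf; last by exists x.
by exists 0 => _ [z _ <-]; exact: (hR z).1.
Qed.

Lemma le_infR (x : X) (y : Y) (l : K) : (forall z, l <= R z y) -> l <= infR R y.
Proof.
move=> hl; apply: lb_le_inf; first by exists (R x y), x.
by move=> _ [z _ <-].
Qed.

Lemma infR_ge0 (x : X) (y : Y) : 0 <= infR R y.
Proof. by apply: (le_infR x) => z; exact: (hR z).1. Qed.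

(** When gamma is 0, the infima are non-negative with zero sum, hence all zero, and the identity
    holds for the default blanket too. The point [x] shows that the input space is inhabited. *)
Lemma infR_omegaB (x : X) (y : Y) : infR R y = gammaB R * omegaB R y.
Proof.
rewrite /omegaB; case: eqP => [g0|/eqP g0]; last by rewrite mulrC divfK.
rewrite g0 mul0r; move: (infR_ge0 x) => /[dup] inf0.
move/(_ y); move/eqP: g0; rewrite psumr_eq0 // => /allP/(_ y).
by rewrite mem_index_enum => /(_ isT)/eqP.
Qed.

Definition clone_map (D : clone_data K X Y) (pi : Y -> cJ D)
    (o : option Y) (o' : option (cJ D)) : K :=
  (o' == omap pi o)%:R.

Definition clone_sample (D : clone_data K X Y) (o : option (cJ D))
    (o' : option Y) : K :=
  match o, o' with
  | Some j, Some y => cQ j y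
  | None, None => 1
  | _, _ => 0
  end.

Lemma is_kernel_clone_sample (D : clone_data K X Y) :
  is_kernel (@cQ _ _ _ D) -> is_kernel (@clone_sample D).
Proof.
move=> hQ [j|]; split.
- by case=> [y|] //=; exact: (hQ j).1.
- by rewrite sum_option /= add0r; exact: (hQ j).2.
- by case=> [y|] /=.
- by rewrite sum_option /= big1 ?addr0.
Qed.

Lemma optimal_of_partition (D : clone_data K X Y) (pi : Y -> cJ D) :
  is_clone_decomp R u ubar D ->
  (forall j y, pi y != j -> cQ j y = 0) ->
  (forall y, infR R y = \sum_(j : cJ D) cC j * cQ j y) ->
  is_optimal_decomp R u ubar D.
Proof.
move=> hD supp hinf; split=> // -[//|k] _.
pose r a := R (if a : bool then ubar else u).
have hr a y : r a y = \sum_(j : cJ D) (if a then cB j else cA j) * cQ j y.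
  by case: a; rewrite /r ?(cB_eq hD) ?(cA_eq hD).
have gE : gammaB R = \sum_(j : cJ D) cC j.
  rewrite /gammaB; under eq_bigr do rewrite hinf.
  rewrite exchange_big /=; apply: eq_bigr => j _.
  by rewrite -mulr_sumr (cQ_dist hD j).2 mulr1.
have bE : cBeta D = 1 - gammaB R by rewrite -(cC_sum hD) gE addrK.
have sample (e : cJ D -> K) (b : K) :
    push (@clone_sample D) (oapp e b) =1
    oapp (fun y => \sum_j e j * cQ j y) b.
  case=> [y|]; rewrite /push sum_option /= ?mulr0 ?add0r // mulr1.
  by rewrite big1 ?addr0 // => j _; rewrite mulr0.
(* Each Q^j is carried by the fibre of [pi] over j, so [pi] applied to a mixture returns its
   coefficients. *)
have proj (e : cJ D -> K) (b : K) :
    push (clone_map pi) (oapp (fun y => \sum_j e j * cQ j y) b) =1 oapp e b.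
  case=> [j|]; rewrite /push /clone_map sum_option /= ?mulr0 ?add0r; last first.
    by rewrite mulr1 big1 ?addr0 // => y _; rewrite mulr0.
  have -> : e j = \sum_y e j * cQ j y.
    by rewrite -mulr_sumr (cQ_dist hD j).2 mulr1.
  apply: eq_bigr => y _.
  have [piy|piy] := eqVneq j (pi y).
    have -> : Some j == Some (pi y) by rewrite piy.
    rewrite mulr1 (bigD1 j) //= big1 ?addr0 // => j' j'j.
    by rewrite supp ?mulr0 // -piy eq_sym.
  have -> : (Some j == Some (pi y)) = false by apply/negbTE.
  by rewrite supp ?mulr0 // eq_sym.
(* Law of each other user in the intermediate experiment on Y + {bot}. *)
pose q := oapp (infR R) (1 - gammaB R).
have pr a : push (clone_map pi) (oapp (r a) 0) =1 gcA01 a.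
  move=> o; have -> : gcA01 a o =
      oapp (fun j : cJ D => if a then cB j else cA j) 0 o.
    by case: o.
  by rewrite -proj; apply: eq_push => -[y|] //=; rewrite hr.
have pq : push (clone_map pi) q =1 @gcA2 _ _ _ D.
  move=> o; have -> : gcA2 o = oapp (@cC _ _ _ D) (1 - gammaB R) o.
    by case: o => //=; rewrite bE.
  by rewrite -proj; apply: eq_push => -[y|] //=; rewrite hinf.
have sr a : push (@clone_sample D) (gcA01 a) =1 oapp (r a) 0.
  move=> o; have -> : oapp (r a) 0 o = oapp (fun y =>
      \sum_(j : cJ D) (if a then cB j else cA j) * cQ j y) 0 o.
    by case: o => //= y; rewrite hr.
  by rewrite -sample; apply: eq_push => -[].
have sq : push (@clone_sample D) (@gcA2 _ _ _ D) =1 q.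
  move=> o; have -> : q o =
      oapp (fun y => \sum_(j : cJ D) cC j * cQ j y) (cBeta D) o.
    by case: o => [y|] /=; rewrite ?hinf ?bE.
  by rewrite -sample; apply: eq_push => -[].
have blanket a := push_dirac_section (@blanket_histK Y k)
  (fun s => hist_law_blanket (r a) s (infR_omegaB u))
  (fun h nz => hist_blanketK (hist_law_None nz)).
(* The first channel encodes (M, Y_M) as a histogram with bots, then applies [pi] to each sample.
   The second redraws each j from Q^j, then reads M off the bots. *)
exists (kcomp (fun s t => (t == blanket_hist s)%:R)
              (hist_kernel (N := k.+1) (clone_map pi))).
exists (kcomp (hist_kernel (N := k.+1) (@clone_sample D))
              (fun t s => (s == hist_blanket t)%:R)).
split.
- move=> s; apply: push_dist; last exact: is_kernel_dirac.
  by apply: is_kernel_hist; exact: is_kernel_dirac.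
- move=> s; apply: push_dist; first exact: is_kernel_dirac.
  by apply: is_kernel_hist; exact: is_kernel_clone_sample (cQ_dist hD).
move=> a; have [b1 b2] := blanket a; split=> h.
  rewrite push_kcomp (eq_push _ b1) push_hist /PGC.
  congr (hist_law _ _ k h); exact/funext.
rewrite push_kcomp -[RHS]b2; apply: eq_push => h'.
rewrite push_hist; congr (hist_law _ _ k h'); exact/funext.
Qed.

End Optimality.

(** * Sums and infima of products over coordinates *)

(** Distributivity is applied to sums over the tagged union of the [T i]; the choices that respect
    the tags are then identified with the dependent functions. *)
Lemma prod_sum_dffun (A : comPzSemiRingType) (I : finType) (T : I -> finType)
    (F : forall i, T i -> A) :
  \prod_i \sum_(t : T i) F i t =
  \sum_(f : {dffun forall i : I, T i}) \prod_i F i (f i).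
Proof.
pose P i := [ffun t : T i => F i t].
transitivity (\prod_i \sum_(t : T i) P i t).
  by apply: eq_bigr => i _; apply: eq_bigr => t _; rewrite ffunE.
under eq_bigr => i _ do rewrite (big_tag (fun i t => P i t)).
rewrite bigA_distr_big_dep -(big_fprod _ _ P).
rewrite (reindex (@dffun_of_fprod I T)) /=; last first.
  exact/onW_bij/dffun_of_fprod_bij.
by apply: eq_bigr => f _; apply: eq_bigr => i _; rewrite !ffunE.
Qed.

Lemma sum_dffun_joint (K : realType) (m : nat) (T : 'I_m -> finType)
    (F : forall i, T i -> K) :
  (forall i, \sum_t F i t = 1) ->
  \sum_(f : {dffun forall i : 'I_m, T i}) \prod_i F i (f i) = 1.
Proof. by move=> F1; rewrite -prod_sum_dffun big1. Qed.

(** The coordinates are replaced by their infima one at a time; with the others frozen, the product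
    is a non-negative multiple of a single coordinate. *)
Lemma prod_inf_ge (K : realType) (I : finType) (A : I -> set K) (l : K) :
  (forall i, A i !=set0)%classic -> (forall i t, A i t -> 0 <= t) ->
  (forall a : I -> K, (forall i, A i (a i)) -> l <= \prod_i a i) ->
  l <= \prod_i inf (A i).
Proof.
move=> A0 Age0 hl.
have infge0 i : 0 <= inf (A i) by apply: lb_le_inf => // t; exact: Age0.
(* [s] holds the coordinates already replaced; [a] must stay general because the induction changes
   it at the new coordinate. *)
suff H (s : {set I}) (a : I -> K) : (forall i, A i (a i)) ->
    l <= \prod_i (if i \in s then inf (A i) else a i).
  have /(_ finset.setT) := H ^~ (fun i => projT1 (cid (A0 i))).
  by under eq_bigr do rewrite finset.in_setT; apply => i; exact: projT2 (cid _).
move: {2}#|s| (leqnn #|s|) => n; elim: n s a => [|n IH] s a sn Aa.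
  move: sn; rewrite leqn0 cards_eq0 => /eqP ->.
  by under eq_bigr do rewrite finset.in_set0; exact: hl.
have [->|[i si]] := set_0Vmem s.
  by under eq_bigr do rewrite finset.in_set0; exact: hl.
rewrite (bigD1 i) //= si; set c := \prod_(j | _) _.
have hc t : A i t -> l <= t * c.
  move=> At; pose a' j := if j == i then t else a j.
  have := IH (s :\ i)%SET a'.
  rewrite (bigD1 i) //= finset.setD11 /= [a' i]/a' eqxx.
  rewrite (_ : \prod_(j | _) _ = c); last first.
    by apply: eq_bigr => j ji; rewrite /a' finset.in_setD1 ji (negPf ji).
  apply; first by move: sn; rewrite (cardsD1 i) si.
  by move=> j; rewrite /a'; case: eqP => // ->.
have c0 : 0 <= c.
  by apply: prodr_ge0 => j _; case: ifP => // _; exact: Age0 (Aa j).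
move: c0; rewrite le_eqVlt => /predU1P[c0|c0].
  by have := hc _ (Aa i); rewrite -c0 !mulr0.
rewrite -ler_pdivrMr //; apply: lb_le_inf => // t At.
by rewrite ler_pdivrMr //; exact: hc.
Qed.

(** Each factor is at least the whole product, the others being at most 1. It serves to deduce that
    all left-over weights vanish when the total one does. *)
Lemma prod_ge0_eq1 (K : realType) (I : finType) (F : I -> K) :
  (forall i, 0 <= F i <= 1) -> \prod_i F i = 1 -> forall i, F i = 1.
Proof.
move=> F01 F1 i; apply/eqP; rewrite eq_le; case/andP: (F01 i) => F0 -> /=.
rewrite -F1 (bigD1 i) //= ler_piMr // prodr_ile1 // => j _; exact: F01.
Qed.

(** * Joint composition *)

Section Joint.

Variables (K : realType) (m : nat) (X : 'I_m -> Type) (Y : 'I_m -> finType).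
Variable R : forall i, X i -> Y i -> K.
Arguments R : clear implicits.

Lemma joint_kernel : (forall i, is_kernel (R i)) -> is_kernel (joint R).
Proof.
move=> hR x; split=> [y|]; first by apply: prodr_ge0 => i _; exact: (hR i _).1.
by apply: (@sum_dffun_joint K m Y (fun i => R i (x i))) => i; exact: (hR i _).2.
Qed.

Lemma infR_joint (x : forall i, X i) (y : {dffun forall i : 'I_m, Y i}) :
  (forall i, is_kernel (R i)) ->
  infR (joint R) y = \prod_i infR (R i) (y i).
Proof.
move=> hR; apply/eqP; rewrite eq_le; apply/andP; split.
  apply: (@prod_inf_ge _ _ (fun i => range (fun z => R i z (y i))))
    => [i|i t [z _ <-]|a ha].
  - by exists (R i (x i) (y i)), (x i).
  - exact: (hR i z).1.
  have ha' i : exists z : X i, R i z (y i) = a i.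
    by have [z _ <-] := ha i; exists z.
  (* Inputs attaining the values [a i] are chosen separately in each coordinate and together form
     one joint input. *)
  pose z i := projT1 (cid (ha' i)).
  have -> : \prod_i a i = joint R z y.
    by apply: eq_bigr => i _; rewrite -(projT2 (cid (ha' i))).
  exact: infR_le (joint_kernel hR) _ _.
apply: (le_infR x) => z; apply: ler_prod => i _.
by rewrite (infR_ge0 (hR i) (x i)) infR_le.
Qed.

End Joint.

(** * Cartesian products of decompositions *)

Section Cartesian.

Variables (K : realType) (m : nat) (X : 'I_m -> Type) (Y : 'I_m -> finType).
Variable R : forall i, X i -> Y i -> K.
Arguments R : clear implicits.
Variables (u ubar : forall i, X i) (D : forall i, clone_data K (X i) (Y i)).
Hypothesis hD : forall i, is_clone_decomp (R i) (u i) (ubar i) (D i).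

Let sumC i : \sum_(j : cJ (D i)) cC j = 1 - cBeta (D i).
Proof. by rewrite -(cC_sum (hD i)) addrC addKr. Qed.

Let beta_le1 i : 0 <= 1 - cBeta (D i) <= 1.
Proof.
rewrite lerBlDr lerDl (cBeta_ge0 (hD i)) andbT -sumC.
by apply: sumr_ge0 => j _; exact: cC_ge0 (hD i) j.
Qed.

Let prod_mix (a : forall i, cJ (D i) -> K) (y : {dffun forall i : 'I_m, Y i}) :
  \prod_i \sum_(j : cJ (D i)) a i j * cQ j (y i) =
  \sum_(j : {dffun forall i : 'I_m, cJ (D i)})
    (\prod_i a i (j i)) * \prod_i cQ (j i) (y i).
Proof.
by rewrite prod_sum_dffun; apply: eq_bigr => j _; rewrite big_split.
Qed.

Let expand (x : forall i, X i) (S : {set 'I_m})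
    (y : {dffun forall i : 'I_m, Y i}) : K :=
  \prod_i (if i \in S then cBeta (D i) * cLO (D i) (x i) (y i)
           else \sum_(j : cJ (D i)) cC j * cQ j (y i)).

Let joint_expand (x : forall i, X i) (y : {dffun forall i : 'I_m, Y i}) :
  joint R x y = \sum_(S : {set 'I_m}) expand x S y.
Proof.
rewrite -bigA_distr; apply: eq_bigr => i _.
by rewrite (cC_eq (hD i)) addrC.
Qed.

(** The term of [S] has mass the product of the beta_i on [S] and of the 1 - beta_i off it. Over all
    [S] these masses add up to 1, and the empty set accounts for the subtracted product. *)
Let sum_expand (x : forall i, X i) :
  \sum_(S : {set 'I_m} | S != finset.set0) \sum_y expand x S y =
  1 - \prod_i (1 - cBeta (D i)).
Proof.
have E S : \sum_y expand x S y =
    \prod_i (if i \in S then cBeta (D i) else 1 - cBeta (D i)).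
  rewrite -(prod_sum_dffun (fun i t => if i \in S then
    cBeta (D i) * cLO (D i) (x i) t else \sum_(j : cJ (D i)) cC j * cQ j t)).
  apply: eq_bigr => i _; case: ifP => _.
    by rewrite -mulr_sumr (cLO_dist (hD i) _).2 mulr1.
  rewrite exchange_big -sumC; apply: eq_bigr => j _.
  by rewrite -mulr_sumr (cQ_dist (hD i) _).2 mulr1.
rewrite (eq_bigr _ (fun S _ => E S)).
have : \prod_i (cBeta (D i) + (1 - cBeta (D i))) = 1.
  by rewrite big1 // => i _; rewrite addrC subrK.
rewrite bigA_distr (bigD1 finset.set0) //= => sum1.
rewrite -[X in _ = X - _]sum1.
under [X in _ = X + _ - _]eq_bigr do rewrite finset.in_set0.
by rewrite [RHS]addrAC subrr add0r.
Qed.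

Let expand_ge0 x S y : 0 <= expand x S y.
Proof.
apply: prodr_ge0 => i _; case: ifP => _.
  by rewrite mulr_ge0 ?(cBeta_ge0 (hD i)) ?(cLO_dist (hD i) _).1.
apply: sumr_ge0 => j _.
by rewrite mulr_ge0 ?(cC_ge0 (hD i)) ?(cQ_dist (hD i) _).1.
Qed.

Lemma cartesian_clone_decomp :
  is_clone_decomp (joint R) u ubar (cartesian D).
Proof.
have beta0 : 0 <= 1 - \prod_i (1 - cBeta (D i)).
  by rewrite subr_ge0 prodr_ile1.
split => //=.
- move=> j; split=> [y|].
    by apply: prodr_ge0 => i _; exact: (cQ_dist (hD i) _).1.
  apply: (@sum_dffun_joint K m Y (fun i => cQ (j i))) => i.
  exact: (cQ_dist (hD i) _).2.
- by move=> j; apply: prodr_ge0 => i _; exact: cA_ge0 (hD i) _.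
- by move=> j; apply: prodr_ge0 => i _; exact: cB_ge0 (hD i) _.
- by move=> j; apply: prodr_ge0 => i _; exact: cC_ge0 (hD i) _.
- apply: (@sum_dffun_joint K m _ (fun i => @cA _ _ _ (D i))) => i.
  exact: cA_sum (hD i).
- apply: (@sum_dffun_joint K m _ (fun i => @cB _ _ _ (D i))) => i.
  exact: cB_sum (hD i).
- rewrite -(prod_sum_dffun (fun i => @cC _ _ _ (D i))).
  by under [X in _ + X]eq_bigr do rewrite sumC; rewrite subrK.
- move=> x; case: eqP => [_|/eqP nz].
    exact: (joint_kernel (fun i => cLO_dist (hD i)) x).
  split=> [y|]; last first.
    by rewrite -mulr_suml exchange_big sum_expand divff.
  by apply: divr_ge0 => //; apply: sumr_ge0 => S _; exact: expand_ge0.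
- by move=> y; rewrite -(prod_mix (fun i => @cA _ _ _ (D i)));
    apply: eq_bigr => i _; exact: cA_eq (hD i) _.
- by move=> y; rewrite -(prod_mix (fun i => @cB _ _ _ (D i)));
    apply: eq_bigr => i _; exact: cB_eq (hD i) _.
move=> x y; rewrite -(prod_mix (fun i => @cC _ _ _ (D i))).
case: eqP => [b0|/eqP nz].
  rewrite b0 mul0r addr0; apply: eq_bigr => i _; rewrite (cC_eq (hD i)).
  (* Zero total left-over weight forces every beta_i to be 0, so each left-over term disappears. *)
  have /eqP := prod_ge0_eq1 beta_le1 (esym (subr0_eq b0)) i.
  by rewrite subr_eq addrC -subr_eq subrr => /eqP <-; rewrite mul0r addr0.
(* The empty set of the expansion is the clone part; all other sets form the left-over. *)
rewrite mulrC divfK // joint_expand (bigD1 finset.set0) //=; congr (_ + _).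
by apply: eq_bigr => i _; rewrite finset.in_set0.
Qed.

Lemma cartesian_optimal (pi : forall i, Y i -> cJ (D i)) :
  (forall i, is_kernel (R i)) ->
  (forall i (j : cJ (D i)) y, pi i y != j -> cQ j y = 0) ->
  (forall i y, infR (R i) y = \sum_(j : cJ (D i)) cC j * cQ j y) ->
  is_optimal_decomp (joint R) u ubar (cartesian D).
Proof.
move=> hR supp hinf.
pose pis (y : {dffun forall i : 'I_m, Y i}) : cJ (cartesian D) :=
  [ffun i => pi i (y i)].
apply: (@optimal_of_partition _ _ _ _ _ _ (joint_kernel hR) _ pis).
- exact: cartesian_clone_decomp.
- move=> j y; have [/forallP H|] := boolP [forall i, pi i (y i) == j i].
    by case/eqP; apply/ffunP => i; rewrite ffunE; exact/eqP.
  (* A single coordinate off its fibre makes a factor of Q^j vanish. *)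
  by rewrite negb_forall => /existsP[i ij] _; apply/eqP/prodf_eq0; exists i;
    rewrite ?supp.
move=> y; rewrite (infR_joint u) // -(prod_mix (fun i => @cC _ _ _ (D i))).
exact: eq_bigr.
Qed.

End Cartesian.

(** * Left-over laws *)

Section Leftover.

Variables (K : realType) (X : Type) (Y : finType) (R : X -> Y -> K).
Variables (u : X) (hR : is_kernel R).

Lemma infR_sum_le1 : \sum_y infR R y <= 1.
Proof. by rewrite -(hR u).2; apply: ler_sum => y _; exact: infR_le. Qed.

(** Since the clone part is the pointwise infimum, what remains of R(x) is non-negative, and its
    mass is [beta] for every x. *)
Lemma leftover_decomp (J : finType) (Q : J -> Y -> K) (c : J -> K) :
  is_kernel Q -> (forall y, infR R y = \sum_j c j * Q j y) ->
  let beta := 1 - \sum_j c j in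
  [/\ 0 <= beta, is_kernel (leftover R Q c beta) &
      forall x y, R x y = \sum_j c j * Q j y + beta * leftover R Q c beta x y].
Proof.
move=> hQ hinf beta.
have sumc : \sum_j c j = \sum_y infR R y.
  under [RHS]eq_bigr do rewrite hinf.
  rewrite exchange_big /=; apply: eq_bigr => j _.
  by rewrite -mulr_sumr (hQ j).2 mulr1.
have b0 : 0 <= beta by rewrite subr_ge0 sumc infR_sum_le1.
have diff_ge0 x y : 0 <= R x y - \sum_j c j * Q j y.
  by rewrite -hinf subr_ge0 infR_le.
have sum_diff x : \sum_y (R x y - \sum_j c j * Q j y) = beta.
  rewrite sumrB (hR x).2 /beta sumc; congr (_ - _).
  by apply: eq_bigr => y _; rewrite hinf.
split=> // [x|x y]; rewrite /leftover.
  case: eqP => [//|/eqP nz]; split=> [y|]; first by rewrite divr_ge0.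
  by rewrite -mulr_suml sum_diff divff.
case: eqP => [bE|/eqP nz]; last by rewrite mulrC divfK // addrC subrK.
(* With [beta] = 0 the non-negative remainder has zero sum, hence vanishes pointwise. *)
rewrite bE mul0r addr0; apply/eqP; rewrite -subr_eq0.
have /eqP := sum_diff x; rewrite bE psumr_eq0 // => /allP/(_ y).
by rewrite mem_index_enum => /(_ isT).
Qed.

End Leftover.

(** * Primary and simplified decompositions *)

Section PartitionDecompositions.

Variables (K : realType) (X : Type) (Y : finType) (R : X -> Y -> K).
Variables (u ubar : X) (hR : is_kernel R).

Let sum_point (a : Y -> K) (y : Y) : \sum_j a j * (y == j)%:R = a y.
Proof. by under eq_bigr do rewrite eq_sym; exact: sum_mulb_eq. Qed.

Lemma primary_clone_decomp : is_clone_decomp R u ubar (primary R u ubar).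
Proof.
have hQ : is_kernel (fun j y : Y => (y == j)%:R : K) := is_kernel_dirac K id.
have [b0 hLO E] :=
  leftover_decomp u hR hQ (fun y => esym (sum_point (infR R) y)).
split=> //=.
- exact: (hR u).1.
- exact: (hR ubar).1.
- exact: infR_ge0 hR u.
- exact: (hR u).2.
- exact: (hR ubar).2.
- by rewrite subrK.
Qed.

Lemma primary_support (j y : Y) :
  y != j -> cQ (c := primary R u ubar) j y = 0.
Proof. by move=> /negPf /= ->. Qed.

Lemma primary_infR (y : Y) :
  infR R y = \sum_j cC (c := primary R u ubar) j * cQ j y.
Proof. by rewrite /= sum_point. Qed.

Hypothesis pos : forall y, 0 < infR R y.

Local Notation D := (simplified R u ubar).

Definition ratio (y : Y) : cJ D :=
  SeqSub (map_f (fun y => (R u y / infR R y, R ubar y / infR R y))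
                (mem_enum predT y)).

Let inf_neq0 y : infR R y != 0. Proof. by rewrite gt_eqF. Qed.

Let mem_classS (j : cJ D) y : (y \in classS R u ubar (val j)) = (ratio y == j).
Proof.
rewrite inE -val_eqE /=; case: (ssval j) => r0 r1 /=.
by rewrite xpair_eqE !(can2_eq (divfK (inf_neq0 y)) (mulfK (inf_neq0 y))).
Qed.

Let sum_classS (F : Y -> K) :
  \sum_(j : cJ D) \sum_(y in classS R u ubar (val j)) F y = \sum_y F y.
Proof.
rewrite [RHS](partition_big ratio predT) //=; apply: eq_bigr => j _.
by apply: eq_bigl => y; rewrite mem_classS.
Qed.

Let cA_ratio (j : cJ D) : cA j = (val j).1 * cC j.
Proof.
rewrite /= mulr_sumr; apply: eq_bigr => y; rewrite inE => /andP[/eqP -> _].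
by [].
Qed.

Let cB_ratio (j : cJ D) : cB j = (val j).2 * cC j.
Proof.
rewrite /= mulr_sumr; apply: eq_bigr => y; rewrite inE => /andP[_ /eqP ->].
by [].
Qed.

Let ratio_surj (j : cJ D) : exists y, ratio y = j.
Proof.
have /mapP[y _ yj] := valP j; exists y; exact: val_inj.
Qed.

Let cC_gt0 (j : cJ D) : 0 < cC j.
Proof.
have [y yj] := ratio_surj j; rewrite /= (bigD1 y) ?mem_classS ?yj //=.
by rewrite ltr_wpDr // sumr_ge0 // => z _; rewrite ltW.
Qed.

(** On a class, R(u) is r0 times the infimum, so normalising either gives the same law. Cancelling
    r0 is legitimate because R(u) dominates a positive infimum. *)
Let cQ_ratio (j : cJ D) y :
  cQ j y = if ratio y == j then infR R y / cC j else 0.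
Proof.
rewrite [LHS](_ : _ =
  if y \in classS R u ubar (val j) then R u y / cA j else 0) // mem_classS.
case: eqP => // yj; rewrite cA_ratio.
have r0 : (val j).1 != 0.
  rewrite -yj /= mulf_neq0 ?invr_eq0 // gt_eqF //.
  exact: lt_le_trans (pos y) (infR_le hR u y).
have: y \in classS R u ubar (val j) by rewrite mem_classS yj.
by rewrite inE => /andP[/eqP -> _]; rewrite -mulf_div divff ?mul1r.
Qed.

(** Only the class of [y] contributes. Taking [e] to be 1, [fst] or [snd] yields the infimum, R(u)
    or R(ubar). *)
Let mix_ratio (e : K * K -> K) y :
  \sum_(j : cJ D) e (val j) * cC j * cQ j y = e (val (ratio y)) * infR R y.
Proof.
rewrite (bigD1 (ratio y)) // big1 => [|j /negPf jy].
  rewrite [LHS]addr0.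
  by rewrite cQ_ratio eqxx -mulrA [cC _ * _]mulrC divfK // gt_eqF.
by rewrite cQ_ratio eq_sym jy mulr0.
Qed.

Lemma simplified_support (j : cJ D) y : ratio y != j -> cQ j y = 0.
Proof. by rewrite cQ_ratio => /negPf ->. Qed.

Lemma simplified_infR y : infR R y = \sum_(j : cJ D) cC j * cQ j y.
Proof.
rewrite -[LHS]mul1r -(mix_ratio (fun=> 1)).
by apply: eq_bigr => j _; rewrite mul1r.
Qed.

Lemma simplified_clone_decomp : is_clone_decomp R u ubar D.
Proof.
have hQ : is_kernel (@cQ _ _ _ D).
  move=> j; split=> [y|].
    rewrite cQ_ratio; case: ifP => // _; apply: divr_ge0; exact/ltW.
  under eq_bigr do rewrite cQ_ratio.
  rewrite -big_mkcond -mulr_suml /= (eq_bigl (mem (classS R u ubar (val j)))).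
    by rewrite divff // gt_eqF //; exact: cC_gt0.
  by move=> y; rewrite -mem_classS.
have [b0 hLO E] := leftover_decomp u hR hQ simplified_infR.
split=> //.
- by move=> j; apply: sumr_ge0 => y _; exact: (hR u).1.
- by move=> j; apply: sumr_ge0 => y _; exact: (hR ubar).1.
- by move=> j; exact/ltW.
- by rewrite sum_classS; exact: (hR u).2.
- by rewrite sum_classS; exact: (hR ubar).2.
- by rewrite subrK.
- move=> y; under eq_bigr do rewrite cA_ratio.
  by rewrite (mix_ratio fst) /= divfK.
- move=> y; under eq_bigr do rewrite cB_ratio.
  by rewrite (mix_ratio snd) /= divfK.
Qed.

End PartitionDecompositions.

Theorem theorem9 (K : realType) (m : nat) (X : 'I_m -> Type)
    (Y : 'I_m -> finType) (R : forall i, X i -> Y i -> K)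
    (hR : forall i, is_kernel (R i))
    (x1 x1bar : forall i, X i) :
  is_optimal_decomp (joint R) x1 x1bar
    (cartesian (fun i => primary (R i) (x1 i) (x1bar i))) /\
  ((forall i y, 0 < infR (R i) y) ->
   is_optimal_decomp (joint R) x1 x1bar
     (cartesian (fun i => simplified (R i) (x1 i) (x1bar i)))).
Proof.
split=> [|pos].
  (* Point masses correspond to the identity as fibre map. *)
  apply: (@cartesian_optimal _ _ _ _ _ _ _
    (fun i => primary (R i) (x1 i) (x1bar i)) _ (fun i (y : Y i) => y)) => // i.
  - exact: primary_clone_decomp.
  - exact: primary_support.
  - exact: primary_infR.
apply: (@cartesian_optimal _ _ _ _ _ _ _
  (fun i => simplified (R i) (x1 i) (x1bar i)) _
  (fun i => @ratio _ _ _ (R i) (x1 i) (x1bar i))) => // i.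
- exact: simplified_clone_decomp.
- exact: simplified_support.
- exact: simplified_infR.
Qed.
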